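(* Consider the one-term Kronecker product model below under the deterministic scheme, along a sequence of models with $M+N\to\infty$. Suppose that (Assumption 1) $\frac{m_0+n_0}{\ln\ln(MN)}\to\infty$ and $\frac{m_0^\dagger+n_0^\dagger}{\ln\ln(MN)}\to\infty$, where $m_0^\dagger=M-m_0$, $n_0^\dagger=N-n_0$, and that (Assumption 2) $\bm E$ has i.i.d. standard normal entries. Let $\hat\lambda,\hat{\bm A},\hat{\bm B}$ be the estimators computed under the true configuration $(m_0,n_0)$ (with the sign of the leading singular pair chosen so that $\langle \mathrm{vec}(\hat{\bm A}),\mathrm{vec}(\bm A)\rangle\ge 0$). Then $$\frac{\hat\lambda-\lambda}{\lambda}=O_p\Big(\frac{r_0}{\lambda/\sigma}\Big),\qquad \|\hat{\bm A}-\bm A\|_F^2=O_p\Big(\frac{r_0}{\lambda/\sigma}\Big),\qquad \|\hat{\bm B}-\bm B\|_F^2=O_p\Big(\frac{r_0}{\lambda/\sigma}\Big),$$ where $r_0=2^{-(m_0+n_0)/2}+2^{-(m_0^\dagger+n_0^\dagger)/2}$.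
   Context: Model: $M,N$ are nonnegative integers and the observed $2^M\times 2^N$ matrix is $\bm Y=\lambda\bm A\otimes\bm B+\sigma 2^{-(M+N)/2}\bm E$, where $\lambda>0$, $\sigma>0$, $\bm A$ is $2^{m_0}\times 2^{n_0}$, $\bm B$ is $2^{M-m_0}\times 2^{N-n_0}$, $\|\bm A\|_F=\|\bm B\|_F=1$, and $\bm E$ is a $2^M\times 2^N$ noise matrix. The pair $(m_0,n_0)$ is the true configuration. Deterministic scheme: $\lambda,\bm A,\bm B$ are non-random. All quantities ($M,N,m_0,n_0,\lambda,\sigma,\bm A,\bm B$) may depend on the index of the sequence; $O_p$ is with respect to this sequence. Vectorization: for a $p\times q$ matrix $\bm C=(c_{ij})$, $\mathrm{vec}(\bm C)=(c_{11},\dots,c_{1q},\dots,c_{p1},\dots,c_{pq})'$ (rows stacked); $\mathrm{vec}^{-1}$ is its inverse for the appropriate dimensions. Rearrangement: for a $2^a\times 2^b$ matrix $\bm C$ and integers $0\le m\le a$, $0\le n\le b$, view $\bm C$ as a $2^m\times 2^n$ array of blocks $\bm C_{i,j}$ of size $2^{a-m}\times 2^{b-n}$; $\mathcal R_{m,n}[\bm C]$ is the $2^{m+n}\times 2^{a+b-m-n}$ matrix whose rows are, in order, $\mathrm{vec}(\bm C_{1,1})',\dots,\mathrm{vec}(\bm C_{1,2^n})',\dots,\mathrm{vec}(\bm C_{2^m,1})',\dots,\mathrm{vec}(\bm C_{2^m,2^n})'$. It satisfies $\mathcal R_{m,n}[\bm A\otimes\bm B]=\mathrm{vec}(\bm A)\mathrm{vec}(\bm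 B)'$ when $\bm A$ is $2^m\times 2^n$. Estimators under configuration $(m,n)$: let $u_1,v_1$ be the leading left/right singular vectors of $\mathcal R_{m,n}[\bm Y]$; $\hat\lambda=\|\mathcal R_{m,n}[\bm Y]\|_S$ (largest singular value), $\hat{\bm A}=\mathrm{vec}^{-1}(u_1)$ ($2^m\times 2^n$), $\hat{\bm B}=\mathrm{vec}^{-1}(v_1)$ ($2^{M-m}\times 2^{N-n}$). *)

(* Defs.v *)
From HB Require Import structures.
From mathcomp Require Import all_boot all_order all_algebra.
From mathcomp Require Import all_classical all_reals all_analysis.
Set Implicit Arguments. Unset Strict Implicit. Unset Printing Implicit Defensive.
Import Order.TTheory GRing.Theory Num.Theory.
Local Open Scope classical_set_scope.
Local Open Scope ring_scope.

Section Defs.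
Variable R : realType.

(* inverse of mathcomp's mxvec_index: a : 'I_(m*n) |-> (i, j) with a = i*n + j *)
Definition pairidx m n (a : 'I_(m * n)) : 'I_m * 'I_n :=
  enum_val (cast_ord (esym (mxvec_cast m n)) a).

(* Kronecker product of A (p x q) and B (r x s); index i*r+k is mxvec_index i k *)
Definition kron p q r s (A : 'M[R]_(p, q)) (B : 'M[R]_(r, s)) : 'M[R]_(p * r, q * s) :=
  \matrix_(x, y) (A (pairidx x).1 (pairidx y).1 * B (pairidx x).2 (pairidx y).2).

(* Rearrangement R_{m,n}: C of size (p*r) x (q*s) seen as p x q array of
   r x s blocks; row (i,j) (row-major order) is vec(C_{i,j})' (row-stacked vec) *)
Definition rearr p q r s (C : 'M[R]_(p * r, q * s)) : 'M[R]_(p * q, r * s) :=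
  \matrix_(a, b) C (mxvec_index (pairidx a).1 (pairidx b).1)
                   (mxvec_index (pairidx a).2 (pairidx b).2).

Definition vec_inv m n (u : 'cV[R]_(m * n)) : 'M[R]_(m, n) := vec_mx u^T.

Definition frob m n (A : 'M[R]_(m, n)) : R := Num.sqrt (\sum_i \sum_j A i j ^+ 2).

Definition frobdot m n (A B : 'M[R]_(m, n)) : R := \sum_i \sum_j A i j * B i j.

Definition specnorm m n (X : 'M[R]_(m, n)) : R :=
  sup [set frob (X *m v) | v in [set v : 'cV[R]_n | frob v = 1]].

Definition leading_pair m n (X : 'M[R]_(m, n)) (u : 'cV[R]_m) (v : 'cV[R]_n) : Prop :=
  frob u = 1 /\ frob v = 1 /\ X *m v = specnorm X *: u /\ X^T *m u = specnorm X *: v.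

(* O_p for a (possibly multivalued, to cover all admissible choices of the
   estimator) sequence of random quantities X k w : set R. *)
Definition bigOp d (Omega : measurableType d) (P : probability Omega R)
  (X : nat -> Omega -> set R) (a : nat -> R) : Prop :=
  forall eps : R, 0 < eps -> exists C : R, 0 < C /\ exists K : nat,
    forall k, (K <= k)%N -> exists G : set Omega, measurable G /\
      (P G >= (1 - eps)%:E)%E /\
      forall w, G w -> forall x, X k w x -> `|x| <= C * a k.

Definition iid_std_normal d (Omega : measurableType d) (P : probability Omega R)
  m n (E : Omega -> 'M[R]_(m, n)) : Prop :=
  (forall i j, measurable_fun setT (fun w => E w i j)) /\
  (forall i j (B : set R), measurable B ->
     P ((fun w => E w i j) @^-1` B) = normal_prob 0 1 B) /\
  (forall B : 'I_m -> 'I_n -> set R, (forall i j, measurable (B i j)) ->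
     P (\bigcap_(ij in [set: 'I_m * 'I_n]) ((fun w => E w ij.1 ij.2) @^-1` B ij.1 ij.2))
     = (\prod_(i < m) \prod_(j < n) P ((fun w => E w i j) @^-1` B i j))%E).

End Defs.

(* Main.v *)
Require Import Defs.
From HB Require Import structures.
From mathcomp Require Import all_boot all_order all_algebra ring lra.
From mathcomp Require Import all_classical all_reals all_analysis.
From mathcomp Require Import measurable_realfun.
Set Implicit Arguments. Unset Strict Implicit.
Unset Printing Implicit Defensive.
Import Order.TTheory GRing.Theory Num.Theory.
Local Open Scope classical_set_scope.
Local Open Scope ring_scope.

(* The rearranged observation is lambda vec(A) vec(B)' plus a rearranged
   Gaussian matrix Z of size P x Q scaled by sigma / sqrt(PQ), where
   P = 2^(m0+n0) and Q = 2^(m0'+n0').  With probability at least 1 - eps one has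
   |Z| <= C_eps (sqrt P + sqrt Q): for y, x in nets of the unit balls,
   exp(t <y, Z x> - t^2 |y|^2 |x|^2 / 2) has mean 1, so a sum of such terms with
   weights of total mass at most 1 has mean at most 1; Markov's inequality and
   the choice t = sqrt(P + Q) bound all <y, Z x> at once.  Hence the noise has
   spectral norm w <= C_eps sigma r0, and the rest is deterministic: Weyl's
   inequality gives |lambdahat - lambda| <= w, and expanding
   lambdahat = <u, X v> gives 1 - <u, a> <v, b> <= 2 w / lambda, which controls
   |u - a|^2 = 2 - 2 <u, a> and |v - b|^2. *)

(** * Frobenius inner product and norm *)

Section Frobenius.
Variable R : realType.
Implicit Types m n : nat.

Lemma frobdotE m n (A B : 'M[R]_(m, n)) : frobdot A B = \tr (A *m B^T).
Proof.
rewrite /frobdot /mxtrace; apply: eq_bigr => i _; rewrite mxE.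
by apply: eq_bigr => j _; rewrite mxE.
Qed.

Lemma frobdotC m n (A B : 'M[R]_(m, n)) : frobdot A B = frobdot B A.
Proof.
by apply: eq_bigr => i _; apply: eq_bigr => j _; rewrite mulrC.
Qed.

Lemma frobdotDl m n (A B C : 'M[R]_(m, n)) :
  frobdot (A + B) C = frobdot A C + frobdot B C.
Proof. by rewrite !frobdotE mulmxDl mxtraceD. Qed.

Lemma frobdotZl m n a (A B : 'M[R]_(m, n)) :
  frobdot (a *: A) B = a * frobdot A B.
Proof. by rewrite !frobdotE -scalemxAl mxtraceZ. Qed.

Lemma frobdotDr m n (A B C : 'M[R]_(m, n)) :
  frobdot A (B + C) = frobdot A B + frobdot A C.
Proof. by rewrite !(frobdotC A) frobdotDl. Qed.

Lemma frobdotZr m n a (A B : 'M[R]_(m, n)) :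
  frobdot A (a *: B) = a * frobdot A B.
Proof. by rewrite !(frobdotC A) frobdotZl. Qed.

Lemma frobdotNl m n (A B : 'M[R]_(m, n)) : frobdot (- A) B = - frobdot A B.
Proof. by rewrite -scaleN1r frobdotZl mulN1r. Qed.

Lemma frobdotNr m n (A B : 'M[R]_(m, n)) : frobdot A (- B) = - frobdot A B.
Proof. by rewrite !(frobdotC A) frobdotNl. Qed.

Lemma frob_ge0 m n (A : 'M[R]_(m, n)) : 0 <= frob A.
Proof. exact: sqrtr_ge0. Qed.

Lemma frob_sqr m n (A : 'M[R]_(m, n)) : frob A ^+ 2 = frobdot A A.
Proof.
rewrite sqr_sqrtr; last first.
  by apply: sumr_ge0 => i _; apply: sumr_ge0 => j _; rewrite sqr_ge0.
by apply: eq_bigr => i _; apply: eq_bigr => j _; rewrite expr2.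
Qed.

Lemma frobE m n (A : 'M[R]_(m, n)) : frob A = Num.sqrt (frobdot A A).
Proof. by rewrite -frob_sqr sqrtr_sqr ger0_norm ?frob_ge0. Qed.

Lemma frobZ m n a (A : 'M[R]_(m, n)) : frob (a *: A) = `|a| * frob A.
Proof.
rewrite frobE frobdotZl frobdotZr mulrA -expr2 sqrtrM ?sqr_ge0//.
by rewrite sqrtr_sqr -frobE.
Qed.

Lemma frobN m n (A : 'M[R]_(m, n)) : frob (- A) = frob A.
Proof. by rewrite -scaleN1r frobZ normrN1 mul1r. Qed.

Lemma frob0 m n : frob (0 : 'M[R]_(m, n)) = 0.
Proof. by rewrite -(scale0r 0) frobZ normr0 mul0r. Qed.

Lemma frob_eq0 m n (A : 'M[R]_(m, n)) : frob A = 0 -> A = 0.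
Proof.
move=> /eqP; rewrite -sqrf_eq0 frob_sqr => /eqP A0.
apply/matrixP => i j; rewrite mxE; apply/eqP; rewrite -sqrf_eq0 expr2.
have ge0 k l : 0 <= A k l * A k l by rewrite -expr2 sqr_ge0.
have Ai0 : \sum_j A i j * A i j = 0.
  by apply: psumr_eq0P A0 _ _ => // k _; exact: sumr_ge0.
by rewrite (psumr_eq0P _ Ai0).
Qed.

(** Cauchy-Schwarz: when both norms are nonzero, expand the square of the norm of
    [frob B *: A - frob A *: B] and divide by [frob A * frob B]. *)
Lemma frobdot_le m n (A B : 'M[R]_(m, n)) : frobdot A B <= frob A * frob B.
Proof.
have [/frob_eq0 ->|A0] := eqVneq (frob A) 0.
  by rewrite frob0 -(scale0r 0) frobdotZl !mul0r.
have [/frob_eq0 ->|B0] := eqVneq (frob B) 0.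
  by rewrite frob0 -(scale0r 0) frobdotZr mul0r mulr0.
have ab0 : 0 < frob A * frob B by rewrite mulr_gt0// lt0r frob_ge0 ?A0 ?B0.
have := sqr_ge0 (frob (frob B *: A - frob A *: B)).
rewrite frob_sqr !(frobdotDl, frobdotDr, frobdotNl, frobdotNr,
  frobdotZl, frobdotZr) -!frob_sqr (frobdotC B) => h.
rewrite -(ler_pM2l ab0); nra.
Qed.

Lemma ler_norm_frobdot m n (A B : 'M[R]_(m, n)) :
  `|frobdot A B| <= frob A * frob B.
Proof.
by rewrite ler_norml lerNl -frobdotNl -(frobN A) frobdot_le frobN frobdot_le.
Qed.

Lemma frobD_le m n (A B : 'M[R]_(m, n)) : frob (A + B) <= frob A + frob B.
Proof.
rewrite -(@ler_pXn2r _ 2) ?nnegrE ?addr_ge0 ?frob_ge0//.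
rewrite frob_sqr !(frobdotDl, frobdotDr) -!frob_sqr (frobdotC B).
have := frobdot_le A B; nra.
Qed.

Lemma frob_mulmx_le m n (X : 'M[R]_(m, n)) (v : 'cV_n) :
  frob (X *m v) <= frob X * frob v.
Proof.
rewrite -(@ler_pXn2r _ 2) ?nnegrE ?mulr_ge0 ?frob_ge0// exprMn !frob_sqr.
rewrite mulr_suml; apply: ler_sum => i _; rewrite big_ord1.
have -> : (X *m v) i 0 = frobdot (row i X)^T v.
  rewrite /frobdot mxE; apply: eq_bigr => j _.
  by rewrite big_ord1 !mxE.
have -> : \sum_j X i j * X i j = frob (row i X)^T ^+ 2.
  by rewrite frob_sqr; apply: eq_bigr => j _; rewrite big_ord1 !mxE.
rewrite -(frob_sqr v) -exprMn -expr2 -real_normK ?num_real//.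
by rewrite ler_pXn2r ?nnegrE ?mulr_ge0 ?frob_ge0// ler_norm_frobdot.
Qed.

End Frobenius.

(** * Spectral norm, rank-one perturbation and reduction to nets *)

Section SpectralNorm.
Variable R : realType.

Lemma frob_le_specnorm m n (X : 'M[R]_(m, n)) (v : 'cV_n) :
  frob (X *m v) <= specnorm X * frob v.
Proof.
have [/frob_eq0 ->|v0] := eqVneq (frob v) 0.
  by rewrite mulmx0 !frob0 mulr0.
have vgt0 : 0 < frob v by rewrite lt0r frob_ge0 v0.
rewrite -ler_pdivrMr//.
have -> : frob (X *m v) / frob v = frob (X *m ((frob v)^-1 *: v)).
  by rewrite -scalemxAr frobZ ger0_norm ?invr_ge0 ?frob_ge0// mulrC.
apply: ub_le_sup; last first.
  exists ((frob v)^-1 *: v) => //=.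
  by rewrite frobZ ger0_norm ?invr_ge0 ?frob_ge0// mulVf.
(* This upper bound makes [sup] a genuine supremum rather than a default value. *)
exists (frob X) => _ [w /= w1 <-].
by rewrite (le_trans (frob_mulmx_le _ _))// w1 mulr1.
Qed.

(** The unit vector [b] makes the set under [sup] nonempty; over an empty set [sup] is 0 and could
    exceed [c]. *)
Lemma specnorm_le m n (X : 'M[R]_(m, n)) (b : 'cV[R]_n) c : frob b = 1 ->
  (forall v : 'cV_n, frob v = 1 -> frob (X *m v) <= c) -> specnorm X <= c.
Proof.
move=> b1 Xc; apply: ge_sup; first by exists (frob (X *m b)), b.
by move=> _ [v /= v1 <-]; exact: Xc.
Qed.

Lemma specnormZ_le m n (Z : 'M[R]_(m, n)) (b : 'cV[R]_n) c :
  frob b = 1 -> 0 <= c -> specnorm (c *: Z) <= c * specnorm Z.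
Proof.
move=> b1 c0; apply: (specnorm_le b1) => v v1.
rewrite -scalemxAl frobZ ger0_norm// ler_wpM2l//.
by rewrite (le_trans (frob_le_specnorm _ _))// v1 mulr1.
Qed.

Lemma rank1_perturbation m n (a : 'cV[R]_m) (b : 'cV[R]_n) (W : 'M[R]_(m, n))
    (lam : R) : frob a = 1 -> frob b = 1 -> 0 < lam ->
  let X := lam *: (a *m b^T) + W in
  `|specnorm X - lam| <= specnorm W /\
  forall u v, leading_pair X u v -> 0 <= frobdot u a ->
    frob (u - a) ^+ 2 <= 8 * (specnorm W / lam) /\
    frob (v - b) ^+ 2 <= 8 * (specnorm W / lam).
Proof.
move=> a1 b1 lam0 X.
have XE (v : 'cV_n) : X *m v = (lam * frobdot v b) *: a + W *m v.
  rewrite mulmxDl -scalemxAl -scalerA; congr (_ *: _ + _).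
  rewrite -mulmxA [b^T *m v]mx11_scalar mul_mx_scalar; congr (_ *: _).
  rewrite mxE /frobdot; apply: eq_bigr => j _.
  by rewrite big_ord1 mxE mulrC.
have bb : frobdot b b = 1 by rewrite -frob_sqr b1 expr1n.
have aa : frobdot a a = 1 by rewrite -frob_sqr a1 expr1n.
have W1 (v : 'cV_n) : frob v = 1 -> frob (W *m v) <= specnorm W.
  by move=> v1; rewrite (le_trans (frob_le_specnorm _ _))// v1 mulr1.
(* Lower half of Weyl's inequality: test [X] on [b], which the rank-one part maps to [lam *: a]. *)
have Xge : lam - specnorm W <= specnorm X.
  have := frob_le_specnorm X b; rewrite b1 mulr1; apply: le_trans.
  have -> : lam = frob (X *m b - W *m b).
    by rewrite XE bb mulr1 addrK frobZ a1 mulr1 gtr0_norm.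
  rewrite lerBlDr (le_trans (frobD_le _ _))// lerD2l frobN W1//.
split.
  rewrite ler_distl Xge andTb.
  apply: (specnorm_le b1) => v v1.
  rewrite XE (le_trans (frobD_le _ _))// lerD ?W1// frobZ a1 mulr1.
  rewrite normrM (gtr0_norm lam0) ler_piMr ?(ltW lam0)//.
  by rewrite (le_trans (ler_norm_frobdot _ _))// v1 b1 mulr1.
move=> u v [u1 [v1 [Xv _]]] ua0.
have uu : frobdot u u = 1 by rewrite -frob_sqr u1 expr1n.
have vv : frobdot v v = 1 by rewrite -frob_sqr v1 expr1n.
have : frobdot u (X *m v) = specnorm X by rewrite Xv frobdotZr uu mulr1.
rewrite XE frobdotDr frobdotZr => Xuv.
have uW : frobdot u (W *m v) <= specnorm W.
  by rewrite (le_trans (frobdot_le _ _))// u1 mul1r W1.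
have ua1 : frobdot u a <= 1.
  by rewrite (le_trans (frobdot_le _ _))// u1 a1 mul1r.
have := ler_norm_frobdot v b; rewrite v1 b1 mul1r ler_norml => /andP[vbN1 vb1].
rewrite !frob_sqr !(frobdotDl, frobdotDr, frobdotNl, frobdotNr).
rewrite (frobdotC a u) (frobdotC b v) aa bb uu vv.
set w := specnorm W / lam.
have wE : specnorm W = w * lam by rewrite /w divfK// gt_eqF.
(* One [w] comes from [Xge], the other from the noise term [uW] in the expansion [Xuv] of
   [specnorm X]. *)
have main : 1 - frobdot v b * frobdot u a <= 2 * w.
  by rewrite -(ler_pM2l lam0); nra.
move: main ua0 ua1 vbN1 vb1 {wE}; move: (frobdot u a) (frobdot v b) w.
move=> x y w main x0 x1 yN1 y1.
(* If [0 <= y], both [1 - x] and [1 - y] are at most [1 - y * x], and the factor 4 would do. If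
   [y < 0], then [main] forces [w >= 1/2], while the squared distances are at most 4: hence the
   factor 8. *)
have [y0|y0] := leP 0 y; split; nra.
Qed.

(** Replacing [u], [v] by net points costs at most a quarter of [specnorm Z] each; this half is
    absorbed on the left, which doubles [M]. *)
Lemma specnorm_le_net m n (Z : 'M[R]_(m, n)) (b : 'cV[R]_n) (M : R) :
  frob b = 1 -> 0 <= M ->
  (forall (u : 'cV[R]_m) (v : 'cV[R]_n), frob u = 1 -> frob v = 1 ->
    exists y x, [/\ frob (u - y) <= 4^-1, frob (v - x) <= 4^-1,
      frob x <= 1 & frobdot y (Z *m x) <= M]) ->
  specnorm Z <= 2 * M.
Proof.
move=> b1 M0 net.
have Z0 : 0 <= specnorm Z.
  by have := frob_le_specnorm Z b; rewrite b1 mulr1; apply/le_trans/frob_ge0.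
suff: specnorm Z <= M + specnorm Z / 2 by lra.
apply: (specnorm_le b1) => v v1.
have [->|Zv0] := eqVneq (frob (Z *m v)) 0; first by lra.
pose u := (frob (Z *m v))^-1 *: (Z *m v).
have u1 : frob u = 1.
  by rewrite frobZ ger0_norm ?invr_ge0 ?frob_ge0// mulVf.
have -> : frob (Z *m v) = frobdot u (Z *m v).
  by rewrite frobdotZl -frob_sqr expr2 mulKf.
have [y [x [uy vx x1 yx]]] := net u v u1 v1.
have -> : frobdot u (Z *m v) = frobdot y (Z *m x) +
    (frobdot (u - y) (Z *m x) + frobdot u (Z *m (v - x))).
  by rewrite mulmxBr !(frobdotDl, frobdotDr, frobdotNl, frobdotNr); ring.
rewrite lerD// (_ : _ / 2 = specnorm Z / 4 + specnorm Z / 4); last by lra.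
rewrite lerD// (le_trans (frobdot_le _ _))//.
  rewrite [leRHS]mulrC ler_pM ?frob_ge0//.
  by rewrite (le_trans (frob_le_specnorm _ _))// ler_piMr.
rewrite u1 mul1r (le_trans (frob_le_specnorm _ _))//.
by rewrite ler_wpM2l.
Qed.

End SpectralNorm.

(** * A weighted net of the unit ball *)

Section Net.
Variable R : realType.

(* Coordinate i carries a sign bit and a magnitude, in steps of 1 / (4 sqrt p):
   coordinatewise rounding towards 0 then moves a unit vector by at most 1/4
   without increasing its norm. *)
Definition netpt p L (z : {ffun 'I_p -> bool * 'I_L}) : 'cV[R]_p :=
  \col_i ((-1) ^+ (z i).1 * (z i).2%:R / (4 * Num.sqrt p%:R)).

(** Here [h] is the inverse of the grid step. With [a = k / h] and [b = 1 / h], truncation gives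
    [a <= |x| <= a + b], and [y] has the sign of [x] and modulus [a]. *)
Lemma round_toward0 (x h : R) : 0 < h ->
  let y := (-1) ^+ (x < 0)%R * (Num.truncn (`|x| * h))%:R / h in
  y ^+ 2 <= x ^+ 2 /\ (x - y) ^+ 2 <= h^-1 ^+ 2.
Proof.
move=> h0; set k := Num.truncn _.
have /andP[kle kgt] : k%:R <= `|x| * h < k.+1%:R.
  by apply: truncn_itv; rewrite mulr_ge0// ltW.
have kh0 : 0 <= k%:R / h by rewrite divr_ge0// ltW.
have khle : k%:R / h <= `|x| by rewrite ler_pdivrMr.
have khgt : `|x| <= k%:R / h + h^-1.
  by rewrite -{2}[h^-1]mul1r -mulrDl natr1 ler_pdivlMr// ltW.
have hV0 : 0 < h^-1 by rewrite invr_gt0.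
move: khle khgt; have [x0|x0] := ltP x 0; rewrite /= ?expr1 ?expr0 -mulrA.
  rewrite ltr0_norm//; move: {kle kgt h0} (h^-1) hV0 (k%:R / h) kh0.
  move=> b b0 a a0 ab ba.
  by split; nra.
rewrite ger0_norm//; move: {kle kgt h0} (h^-1) hV0 (k%:R / h) kh0.
move=> b b0 a a0 ab ba.
by split; nra.
Qed.

(** Each of the [p] coordinates moves by at most [1 / (4 sqrt p)], so the total squared error is at
    most 1/16. The last conclusion keeps the weight of the chosen net point from being too small. *)
Lemma netpt_approx p (u : 'cV[R]_p) : frob u = 1 ->
  exists z : {ffun 'I_p -> bool * 'I_(4 * p).+1},
    [/\ frob (u - netpt z) <= 4^-1, frob (netpt z) <= 1 &
        (\sum_i (z i).2 <= 4 * p)%N].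
Proof.
move=> u1.
have uu : \sum_i u i 0 ^+ 2 = 1.
  rewrite -[RHS](expr1n _ 2) -u1 frob_sqr; apply: eq_bigr => i _.
  by rewrite big_ord1 expr2.
have p0 : (0 < p)%N.
  case: p u u1 uu => // u _; rewrite big_ord0 => /eqP.
  by rewrite eq_sym oner_eq0.
pose r : R := Num.sqrt p%:R.
have r0 : 0 < r by rewrite sqrtr_gt0 ltr0n.
have rr : r ^+ 2 = p%:R by rewrite sqr_sqrtr ?ler0n.
have h0 : 0 < 4 * r by rewrite mulr_gt0.
pose k i := Num.truncn (`|u i 0| * (4 * r)).
(* From [(|u_i| r - 1)^2 >= 0]. Since [u] is a unit vector, summing over [i] gives
   [2 (p + p) = 4 p]. *)
have kle i : (k i)%:R <= 2 * (u i 0 ^+ 2 * p%:R + 1).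
  have /andP[kle _] : (k i)%:R <= `|u i 0| * (4 * r) < (k i).+1%:R.
    by apply: truncn_itv; rewrite mulr_ge0// ltW.
  rewrite (le_trans kle)// -rr -(real_normK (num_real (u i 0))).
  by have := sqr_ge0 (`|u i 0| * r - 1); nra.
have sumk : (\sum_i k i <= 4 * p)%N.
  rewrite -(ler_nat R) natr_sum (le_trans (ler_sum _ (fun i _ => kle i)))//.
  rewrite -mulr_sumr big_split/= -mulr_suml uu sumr_const card_ord natrM.
  by rewrite mul1r; lra.
have klt i : (k i < (4 * p).+1)%N.
  by rewrite ltnS (leq_trans _ sumk)// (bigD1 i)//= leq_addr.
exists [ffun i => (u i 0 < 0, Ordinal (klt i))].
have netE i : (netpt [ffun i => (u i 0 < 0, Ordinal (klt i))]) i 0 =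
    (-1) ^+ (u i 0 < 0)%R * (k i)%:R / (4 * r) by rewrite mxE ffunE.
split.
- rewrite -(@ler_pXn2r _ 2) ?nnegrE ?frob_ge0 ?invr_ge0// frob_sqr.
  rewrite (_ : 4^-1 ^+ 2 = \sum_(i < p) (4 * r)^-1 ^+ 2); last first.
    rewrite sumr_const card_ord -[_ *+ p]mulr_natr -rr -exprMn invfM mulfVK//.
    by rewrite gt_eqF.
  apply: ler_sum => i _; rewrite big_ord1 mxE [(- netpt _) i 0]mxE netE -expr2.
  by have [] := round_toward0 (u i 0) h0.
- rewrite -(@ler_pXn2r _ 2) ?nnegrE ?frob_ge0// frob_sqr expr1n -uu.
  apply: ler_sum => i _; rewrite big_ord1 netE -expr2.
  by have [] := round_toward0 (u i 0) h0.
- by under eq_bigr do rewrite ffunE.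
Qed.

(* Summable weights replace the count of the net points: the union bound
   becomes Markov's inequality for one weighted sum. *)
Definition netwt p L (z : {ffun 'I_p -> bool * 'I_L}) : R :=
  expR (- (\sum_i ((z i).2 + 2))%:R).

(** The sum factors over the coordinates. In each factor, one unit of the shift 2 bounds the
    geometric sum over magnitudes by 1, and the other gives a factor [1/e <= 1/2] that pays for the
    two signs. *)
Lemma sum_netwt_le1 p L : \sum_(z : {ffun 'I_p -> bool * 'I_L}) netwt z <= 1.
Proof.
pose f (c : bool * 'I_L) : R := expR (- (c.2 + 2)%:R).
have -> : \sum_(z : {ffun 'I_p -> bool * 'I_L}) netwt z =
    \prod_(i < p) \sum_c f c.
  rewrite bigA_distr_bigA; apply: eq_bigr => z _.
  by rewrite /netwt natr_sum -sumrN expR_sum.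
apply: prodr_ile1 => i _; apply/andP; split.
  by apply: sumr_ge0 => c _; exact: expR_ge0.
have e2 : 2 <= expR 1 :> R by rewrite (le_trans _ (expR_ge1Dx 1)).
(* The subtracted term makes the induction close, using only that [e >= 2]. *)
have geo n : \sum_(l < n) expR (- (l + 1)%:R) <= 1 - expR (- n%:R) :> R.
  elim: n => [|n IH]; first by rewrite big_ord0 oppr0 expR0 subrr.
  rewrite big_ord_recr/= (le_trans (lerD IH (lexx _)))//.
  have := expR_gt0 (- (n.+1)%:R : R).
  have -> : expR (- n%:R) = expR (- n.+1%:R) * expR 1 :> R.
    by rewrite -expRD -natr1; congr expR; ring.
  by rewrite addn1; nra.
rewrite -(pair_bigA _ (fun b l => f (b, l)))/= big_bool/= /f/=.
have -> : \sum_(l < L) expR (- (l + 2)%:R) =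
    (\sum_(l < L) expR (- (l + 1)%:R)) * expR (- 1) :> R.
  rewrite mulr_suml; apply: eq_bigr => l _; rewrite -expRD.
  by congr expR; rewrite !natrD; ring.
have := geo L; have := expR_gt0 (- L%:R : R).
have e1 : expR (- 1) * expR 1 = 1 :> R by rewrite -expRD addNr expR0.
have := expR_gt0 (- 1 : R); set a := \sum_(_ < _) _ => b0 c0 ac.
have : 0 <= a by apply: sumr_ge0 => l _; exact: expR_ge0.
nra.
Qed.

End Net.

(** * Vectorization, rearrangement and Kronecker products *)

Lemma mxvec_index_pairidx m n (a : 'I_(m * n)) :
  mxvec_index (pairidx a).1 (pairidx a).2 = a.
Proof.
rewrite /mxvec_index -surjective_pairing /pairidx enum_valK.
by rewrite cast_ordKV.
Qed.

Lemma pairidx_mxvec_index m n (i : 'I_m) (j : 'I_n) :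
  pairidx (mxvec_index i j) = (i, j).
Proof. by rewrite /pairidx /mxvec_index cast_ordK enum_rankK. Qed.

Section Rearrangement.
Variable R : realType.

Lemma mxvec_pairidx m n (A : 'M[R]_(m, n)) (a : 'I_(m * n)) :
  mxvec A 0 a = A (pairidx a).1 (pairidx a).2.
Proof. by rewrite -{1}(mxvec_index_pairidx a) mxvecE. Qed.

Lemma sum_pairidx m n (F : 'I_m -> 'I_n -> R) :
  \sum_(a : 'I_(m * n)) F (pairidx a).1 (pairidx a).2 = \sum_i \sum_j F i j.
Proof.
rewrite pair_bigA (reindex (fun ij => mxvec_index ij.1 ij.2))/=.
  by apply: eq_bigr => -[i j] _; rewrite pairidx_mxvec_index.
exists (@pairidx m n) => [[i j] _|a _]; first by rewrite pairidx_mxvec_index.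
exact: mxvec_index_pairidx.
Qed.

Lemma rearrD p q r s (C D : 'M[R]_(p * r, q * s)) :
  rearr (C + D) = rearr C + rearr D.
Proof. by apply/matrixP => a b; rewrite !mxE. Qed.

Lemma rearrZ p q r s c (C : 'M[R]_(p * r, q * s)) :
  rearr (c *: C) = c *: rearr C.
Proof. by apply/matrixP => a b; rewrite !mxE. Qed.

(** The double transpose gives the shape [a *m b^T] of [rank1_perturbation], with columns [a] and
    [b]. *)
Lemma rearr_kron p q r s (A : 'M[R]_(p, q)) (B : 'M[R]_(r, s)) :
  rearr (kron A B) = (mxvec A)^T *m (mxvec B)^T^T.
Proof.
apply/matrixP => a b; rewrite !mxE big_ord1 !pairidx_mxvec_index/= !mxE.
by rewrite !mxvec_pairidx.
Qed.

Lemma vec_invK m n (u : 'cV[R]_(m * n)) : (mxvec (vec_inv u))^T = u.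
Proof. by rewrite /vec_inv vec_mxK trmxK. Qed.

Lemma frobdot_mxvec m n (A B : 'M[R]_(m, n)) :
  frobdot (mxvec A)^T (mxvec B)^T = frobdot A B.
Proof.
rewrite /frobdot -(sum_pairidx (fun i j => A i j * B i j)).
by apply: eq_bigr => a _; rewrite big_ord1 !mxE !mxvec_pairidx.
Qed.

Lemma frobdot_vec_inv m n (u : 'cV[R]_(m * n)) (A : 'M[R]_(m, n)) :
  frobdot (vec_inv u) A = frobdot u (mxvec A)^T.
Proof. by rewrite -frobdot_mxvec vec_invK. Qed.

Lemma frob_mxvec m n (A : 'M[R]_(m, n)) : frob (mxvec A)^T = frob A.
Proof. by rewrite !frobE frobdot_mxvec. Qed.

Lemma frob_vec_inv m n (u : 'cV[R]_(m * n)) :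
  frob (vec_inv u) = frob u.
Proof. by rewrite -frob_mxvec vec_invK. Qed.

Lemma frob_vec_invB m n (u : 'cV[R]_(m * n)) (A : 'M[R]_(m, n)) :
  frob (vec_inv u - A) = frob (u - (mxvec A)^T).
Proof. by rewrite -frob_mxvec linearB/= linearB/= vec_invK. Qed.

(** Turns the bilinear form of the rearranged noise into a linear form in [E] itself, so the
    Gaussian law is used only for the original entries. *)
Lemma frobdot_rearr p q r s (E : 'M[R]_(p * r, q * s))
    (y : 'cV_(p * q)) (x : 'cV_(r * s)) :
  frobdot y (rearr E *m x) = frobdot (kron (vec_inv y) (vec_inv x)) E.
Proof.
pose F i j k l := vec_inv y i j * vec_inv x k l *
  E (mxvec_index i k) (mxvec_index j l).
transitivity (\sum_i \sum_j \sum_k \sum_l F i j k l).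
  rewrite /frobdot -(sum_pairidx (fun i j => \sum_k \sum_l F i j k l)).
  apply: eq_bigr => a _; rewrite big_ord1 mxE mulr_sumr.
  rewrite -(sum_pairidx (F _ _)); apply: eq_bigr => b _.
  by rewrite /F !mxE !mxvec_index_pairidx; ring.
transitivity (\sum_(i : 'I_(p * r)) \sum_(j : 'I_(q * s))
    F (pairidx i).1 (pairidx j).1 (pairidx i).2 (pairidx j).2); last first.
  apply: eq_bigr => i _; apply: eq_bigr => j _.
  by rewrite /F !mxvec_index_pairidx [kron _ _ _ _]mxE.
rewrite (sum_pairidx (fun i k => \sum_j F i (pairidx j).1 k (pairidx j).2)).
apply: eq_bigr => i _; rewrite exchange_big/=; apply: eq_bigr => k _.
by rewrite (sum_pairidx (fun j l => F i j k l)).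
Qed.

(** Gives the variance of the linear form of [frobdot_rearr]. *)
Lemma frob_kron p q r s (A : 'M[R]_(p, q)) (B : 'M[R]_(r, s)) :
  frob (kron A B) = frob A * frob B.
Proof.
suff H : frobdot (kron A B) (kron A B) = frobdot A A * frobdot B B.
  rewrite frobE H sqrtrM -?frob_sqr ?sqr_ge0// !sqrtr_sqr.
  by rewrite !ger0_norm ?frob_ge0.
pose F i j k l := (A i j * B k l) * (A i j * B k l).
rewrite /frobdot.
under eq_bigr => i _ do under eq_bigr => j _ do rewrite !mxE.
rewrite (sum_pairidx (fun i k => \sum_j F i (pairidx j).1 k (pairidx j).2)).
rewrite mulr_suml; apply: eq_bigr => i _.
under eq_bigr => k _ do rewrite (sum_pairidx (fun j l => F i j k l)).
rewrite exchange_big mulr_suml; apply: eq_bigr => j _ /=.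
rewrite mulr_sumr; apply: eq_bigr => k _; rewrite mulr_sumr.
by apply: eq_bigr => l _; rewrite /F; ring.
Qed.

End Rearrangement.

(** * Integrals against densities and products of independent variables *)

(* Applied to a density (mu Lebesgue, phi = id) and to independence (phi one of
   the variables, g the product of the other factors). *)
Section WeightedIntegral.
Import HBNNSimple.
Variables (R : realType) (d1 d2 : measure_display).
Variables (T1 : measurableType d1) (T2 : measurableType d2).
Variables (mu : {measure set T1 -> \bar R}) (nu : {measure set T2 -> \bar R}).
Variables (phi : T1 -> T2) (g : T1 -> R) (c : R).
Hypotheses (mphi : measurable_fun setT phi) (mg : measurable_fun setT g).
Hypotheses (g0 : forall x, 0 <= g x).
Hypothesis gphi : forall B, measurable B ->
  (\int[mu]_x (g x * \1_B (phi x))%:E = c%:E * nu B)%E.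

Lemma integral_weighted_nnsfun (s : {nnsfun T2 >-> R}) :
  (\int[mu]_x (g x * s (phi x))%:E = c%:E * \int[nu]_y (s y)%:E)%E.
Proof.
have m1 r : measurable_fun setT (\1_(s @^-1` [set r]) : T2 -> R).
  exact/measurable_indicP.
transitivity (\int[mu]_x (\sum_(r \in range s)
    (r * (g x * \1_(s @^-1` [set r]) (phi x)))%:E))%E.
  apply: eq_integral => x _; rewrite fsumEFin// {1}(fimfunE s (phi x)).
  rewrite mulr_fsumr//; congr EFin; apply: eq_fsbigr => r _.
  by rewrite mulrCA.
rewrite ge0_integral_fsum//; last 2 first.
- move=> r; apply/measurable_EFinP; apply: measurable_funM => //.
  apply: measurable_funM => //; exact: measurableT_comp.
- move=> r x _; rewrite mulrCA EFinM mule_ge0 ?lee_fin//.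
  exact: nnfun_muleindic_ge0.
transitivity (c%:E * \int[nu]_y (\sum_(r \in range s)
    (r * \1_(s @^-1` [set r]) y)%:E))%E; last first.
  congr (_ * _)%E; apply: eq_integral => y _.
  by rewrite fsumEFin// -fimfunE.
rewrite ge0_integral_fsum//; last 2 first.
- by move=> r; apply/measurable_EFinP; exact: measurable_funM.
- by move=> r y _; exact: nnfun_muleindic_ge0.
rewrite ge0_mule_fsumr; last first.
  by move=> r; apply: integral_ge0 => y _; exact: nnfun_muleindic_ge0.
apply: eq_fsbigr => r; rewrite inE => -[y _ <-].
under eq_integral do rewrite EFinM.
rewrite ge0_integralZl_EFin//; last 2 first.
- by move=> x _; rewrite lee_fin mulr_ge0.
- apply/measurable_EFinP; apply: measurable_funM => //.
  exact: measurableT_comp.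
rewrite gphi//.
under [in RHS]eq_integral do rewrite EFinM.
rewrite ge0_integralZl_EFin//; last first.
  exact/measurable_EFinP.
by rewrite integral_indic// setIT muleCA.
Qed.

(** Simple functions increase to [f]; monotone convergence applies on both sides, and the two limits
    agree. *)
Lemma integral_weighted (f : T2 -> R) : measurable_fun setT f ->
  (forall y, 0 <= f y) ->
  (\int[mu]_x (g x * f (phi x))%:E = c%:E * \int[nu]_y (f y)%:E)%E.
Proof.
move=> mf f0.
have mEf : measurable_fun setT (EFin \o f) by exact/measurable_EFinP.
pose h := nnsfun_approx measurableT mEf.
have hf y : (h n y)%:E @[n --> \oo] --> (f y)%:E.
  by apply: (cvg_nnsfun_approx measurableT mEf) => // t _; rewrite lee_fin.
have hnd y : nondecreasing_seq (fun n => h n y).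
  by move=> m n mn; exact/lefP/nd_nnsfun_approx.
have R1 : (\int[nu]_y (h n y)%:E)%E @[n --> \oo] --> (\int[nu]_y (f y)%:E)%E.
  have -> : (\int[nu]_y (f y)%:E = \int[nu]_y limn (fun n => (h n y)%:E))%E.
    by apply: eq_integral => y _; apply/esym/cvg_lim.
  apply: cvg_monotone_convergence => //.
  - by move=> n; exact/measurable_EFinP/measurable_funP.
  - by move=> n y _; rewrite lee_fin.
  - by move=> y _ m n mn; rewrite lee_fin; exact: hnd.
have R2 : (\int[mu]_x (g x * h n (phi x))%:E)%E @[n --> \oo] -->
    (\int[mu]_x (g x * f (phi x))%:E)%E.
  have -> : (\int[mu]_x (g x * f (phi x))%:E =
      \int[mu]_x limn (fun n => (g x * h n (phi x))%:E))%E.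
    apply: eq_integral => x _; apply/esym/cvg_lim => //.
    under eq_fun do rewrite EFinM.
    by rewrite EFinM; apply: cvgeZl.
  apply: cvg_monotone_convergence => //.
  - move=> n; apply/measurable_EFinP; apply: measurable_funM => //.
    exact: measurableT_comp.
  - by move=> n x _; rewrite lee_fin mulr_ge0.
  - by move=> x _ m n mn; rewrite lee_fin ler_wpM2l//; exact: hnd.
apply: (cvg_unique _ R2) => //.
rewrite (_ : (fun n => \int[mu]_x (g x * h n (phi x))%:E)%E =
    (fun n => c%:E * \int[nu]_y (h n y)%:E)%E); first exact: cvgeZl.
by apply/funext => n; exact: integral_weighted_nnsfun.
Qed.

End WeightedIntegral.

(** Completing the square: the standard density times [expR (t * x)] is [expR (t ^+ 2 / 2)] times
    the normal density of mean [t]. *)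
Lemma integral_normal_prob_expR (R : realType) (t : R) :
  (\int[normal_prob 0 1]_x (expR (t * x))%:E = (expR (t ^+ 2 / 2))%:E)%E.
Proof.
have mpdf := @measurable_normal_pdf R 0 1.
have mexp : measurable_fun setT (fun x : R => expR (t * x)).
  by apply: measurableT_comp => //; exact: measurable_funM.
rewrite -[LHS]mul1e -(@integral_weighted R _ _ _ _ lebesgue_measure
  (normal_prob 0 1) id (normal_pdf 0 1) 1)//; last 2 first.
- by move=> x; exact: normal_pdf_ge0.
- move=> B mB; rewrite mul1e /normal_prob [RHS]integral_mkcond.
  by apply: eq_integral => x _; rewrite epatch_indic EFinM.
transitivity (\int[lebesgue_measure]_x
    ((expR (t ^+ 2 / 2))%:E * (normal_pdf t 1 x)%:E))%E.
  apply: eq_integral => x _; rewrite -EFinM; congr EFin.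
  rewrite !normal_pdfE ?oner_eq0//.
  change (normal_peak 1 * normal_fun 0 1 x * expR (t * x) =
    expR (t ^+ 2 / 2) * (normal_peak 1 * normal_fun t 1 x)).
  rewrite /normal_fun -mulrA -expRD mulrCA -expRD; congr (_ * expR _).
  by rewrite !expr1n; field.
rewrite ge0_integralZl_EFin//.
- by rewrite integral_normal_pdf mule1.
- by move=> x _; rewrite lee_fin normal_pdf_ge0.
- by apply/measurable_EFinP; exact: measurable_normal_pdf.
Qed.

Section IndependentProduct.
Variables (R : realType) (d d' : measure_display).
Variables (T : measurableType d) (T' : measurableType d').
Variables (P : probability T R) (N : probability T' R).
Variables (I : finType) (X : I -> T -> T').
Hypothesis mX : forall i, measurable_fun setT (X i).
Hypothesis indepX : forall B : I -> set T', (forall i, measurable (B i)) ->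
  (P (\bigcap_(i in [set: I]) (X i @^-1` B i)) = \prod_i N (B i))%E.

Lemma integral_prod_indep (f : I -> T' -> R) (e : I -> R) :
  (forall i, measurable_fun setT (f i)) -> (forall i y, 0 <= f i y) ->
  (forall i, \int[N]_y (f i y)%:E = (e i)%:E)%E ->
  (\int[P]_w (\prod_i f i (X i w))%:E = (\prod_i e i)%:E)%E.
Proof.
(* induction on s: the factors outside s are indicators *)
suff main (s : seq I) : forall (f : I -> T' -> R) (e : I -> R),
    (forall i, measurable_fun setT (f i)) -> (forall i y, 0 <= f i y) ->
    (forall i, \int[N]_y (f i y)%:E = (e i)%:E)%E ->
    (forall i, i \notin s -> exists2 B, measurable B & f i = \1_B) ->
    (\int[P]_w (\prod_i f i (X i w))%:E = (\prod_i e i)%:E)%E.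
  move=> mf f0 fe; apply: (main (enum I)) => // i.
  by rewrite mem_enum.
elim: s => [|i0 s IH] {}f {}e mf f0 fe fB.
  (* Base case: all factors are indicators, so the integrand is the indicator of a rectangle and
     [indepX] applies. *)
  have /choice[B BE] i : exists B : set T', measurable B /\ f i = \1_B.
    by have [//|B mB fiB] := fB i; exists B.
  have mB i : measurable (B i) by have [] := BE i.
  transitivity (P (\bigcap_(i in [set: I]) (X i @^-1` B i))).
    have mI : measurable (\bigcap_(i in [set: I]) (X i @^-1` B i)).
      apply: fin_bigcap_measurable => // i _.
      by rewrite -[X in measurable X]setTI; exact: mX.
    rewrite -(setIT (\bigcap_(i in _) _)) -integral_indic//.
    apply: eq_integral => w _; congr EFin.
    rewrite indicE; case: (boolP (w \in _)) => [|].
      rewrite inE => wB.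
      rewrite big1// => i _; have [_ ->] := BE i.
      by rewrite indicE mem_set//; exact: wB.
    move=> /negP wB.
    have [i wBi] : exists i, ~ B i (X i w).
      by apply/existsNP => wBi; apply: wB; rewrite inE => i _; exact: wBi.
    apply/eqP/prodf_eq0; exists i => //; have [_ ->] := BE i.
    by rewrite indicE memNset.
  rewrite indepX// -prodEFin; apply: eq_bigr => i _.
  by have [_ fiB] := BE i; rewrite -fe fiB integral_indic// setIT.
(* With [f i0] replaced by an indicator the induction hypothesis applies. This is the hypothesis on
   indicators that [integral_weighted] needs to restore [f i0], the remaining factors being the
   weight. *)
have indicator_factor B : measurable B ->
    (\int[P]_w (\prod_(i | i != i0) f i (X i w) * \1_B (X i0 w))%:E =
     (\prod_(i | i != i0) e i)%:E * N B)%E.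
  move=> mB.
  have := IH (fun i => if i == i0 then \1_B else f i)
    (fun i => if i == i0 then fine (N B) else e i).
  rewrite (bigD1 i0)//= eqxx EFinM fineK ?fin_num_measure// muleC.
  rewrite (eq_bigr e) => [<-|i /negPf->//].
  - apply: eq_integral => w _; rewrite [in RHS](bigD1 i0)//= eqxx mulrC.
    by congr (_ * _)%:E; apply: eq_bigr => i /negPf ->.
  - by move=> i; case: ifP => // _; exact/measurable_indicP.
  - by move=> i y; case: ifP.
  - move=> i; case: ifP => // _.
    by rewrite integral_indic// setIT fineK ?fin_num_measure.
  - move=> i is0; case: ifPn => ii0; first by exists B.
    by apply: fB; rewrite inE negb_or ii0.
rewrite (bigD1 i0)//= mulrC EFinM -fe -(@integral_weighted _ _ _ _ _ P N (X i0)
  (fun w => \prod_(i | i != i0) f i (X i w)))//; last 2 first.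
- under eq_fun do rewrite -big_filter.
  by apply: measurable_prod => i _; exact: measurableT_comp.
- by move=> w; apply: prodr_ge0.
by apply: eq_integral => w _; rewrite (bigD1 i0)//= mulrC.
Qed.

End IndependentProduct.

Lemma le_bigsum (R : realType) (I : finType) (i : I) (F : I -> R) :
  (forall j, 0 <= F j) -> F i <= \sum_j F j.
Proof. by move=> F0; rewrite (bigD1 i)//= lerDl sumr_ge0. Qed.

(** * Spectral norm of a rearranged Gaussian matrix *)

Section GaussianMatrix.
Variables (R : realType) (d : measure_display) (Omega : measurableType d).
Variable P : probability Omega R.

Lemma measurable_frobdot m n (E : Omega -> 'M[R]_(m, n)) (T : 'M[R]_(m, n)) :
  (forall i j, measurable_fun setT (fun w => E w i j)) ->
  measurable_fun setT (fun w => frobdot T (E w)).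
Proof.
move=> mE; apply: measurable_sum => i; apply: measurable_sum => j.
exact: measurable_funM.
Qed.

Lemma integral_expR_frobdot m n (E : Omega -> 'M[R]_(m, n)) (T : 'M[R]_(m, n)) :
  iid_std_normal P E ->
  (\int[P]_w (expR (frobdot T (E w)))%:E = (expR (frob T ^+ 2 / 2))%:E)%E.
Proof.
move=> [mE [EN indE]].
have mX (ij : 'I_m * 'I_n) : measurable_fun setT (fun w => E w ij.1 ij.2).
  exact: mE.
have indX (B : 'I_m * 'I_n -> set R) : (forall ij, measurable (B ij)) ->
    (P (\bigcap_(ij in [set: 'I_m * 'I_n]) ((fun w => E w ij.1 ij.2) @^-1` B ij))
     = \prod_ij normal_prob 0 1 (B ij))%E.
  move=> mB; have := indE (fun i j => B (i, j)) (fun i j => mB (i, j)).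
  rewrite pair_bigA/= (eq_bigr (fun ij => normal_prob 0 1 (B ij))); last first.
    by move=> [i j] _; rewrite EN.
  by move=> <-; congr (P _); apply: eq_bigcapr => -[i j] _.
have mf (ij : 'I_m * 'I_n) :
    measurable_fun setT (fun x : R => expR (T ij.1 ij.2 * x)).
  by apply: measurableT_comp => //; exact: measurable_funM.
have := @integral_prod_indep R _ _ _ _ P (normal_prob 0 1) _ _ mX indX _ _ mf
  (fun ij y => expR_ge0 _)
  (fun ij => integral_normal_prob_expR _).
rewrite -expR_sum -mulr_suml.
rewrite -(pair_bigA _ (fun i j => T i j ^+ 2))/=.
have -> : \sum_i \sum_j T i j ^+ 2 = frob T ^+ 2.
  by rewrite frob_sqr; apply: eq_bigr => i _; apply: eq_bigr => j _.
move=> <-; apply: eq_integral => w _; rewrite -expR_sum.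
by rewrite -(pair_bigA _ (fun i j => T i j * E w i j)).
Qed.

(** Markov's inequality: off the event, [eps * W] exceeds 1, so it dominates the indicator of the
    complement. *)
Lemma probability_le_inv (W : Omega -> R) (eps : R) : 0 < eps ->
  measurable_fun setT W -> (forall w, 0 <= W w) ->
  ((\int[P]_w (W w)%:E) <= 1)%E ->
  measurable [set w | W w <= eps^-1] /\
  ((1 - eps)%:E <= P [set w | (W w <= eps^-1)%R])%E.
Proof.
move=> eps0 mW W0 W1.
have mG : measurable [set w | W w <= eps^-1].
  rewrite -[X in measurable X]setTI.
  rewrite (_ : [set w | _] = W @^-1` `]-oo, eps^-1]); first exact: mW.
  by apply/seteqP; split => w /=; rewrite in_itv.
split=> //; set G := [set w | _] in mG *.
have mGC : measurable (~` G) by exact: measurableC.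
suff PGC : (P (~` G) <= eps%:E)%E.
  rewrite -(setCK G) probability_setC// EFinB.
  by apply: leeB.
rewrite -(setIT (~` G)) -integral_indic//.
apply: (@le_trans _ _ (\int[P]_w (eps%:E * (W w)%:E))%E).
  apply: ge0_le_integral => //.
  - by apply/measurable_EFinP/measurable_indicP.
  - by apply/measurable_EFinP; apply: measurable_funM.
  - move=> w _; rewrite -EFinM lee_fin indicE; case: (boolP (w \in _)) => [|_].
      rewrite inE /G /= => /negP; rewrite -ltNge => /ltW.
      by move=> Ww; rewrite -ler_pdivrMl// mulr1.
    by rewrite mulr_ge0// (ltW eps0).
rewrite ge0_integralZl_EFin ?(ltW eps0)//; last 2 first.
- by move=> w _; rewrite lee_fin.
- exact/measurable_EFinP.
by rewrite (le_trans (lee_wpmul2l _ W1)) ?mule1// lee_fin ltW.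
Qed.

Lemma gaussian_specnorm p q r s (E : Omega -> 'M[R]_(p * r, q * s))
    (b : 'cV[R]_(r * s)) (eps : R) :
  iid_std_normal P E -> 0 < eps -> frob b = 1 -> (0 < p * q)%N ->
  exists G : set Omega, measurable G /\ ((1 - eps)%:E <= P G)%E /\
  forall w, G w -> specnorm (rearr (E w)) <=
    (13 + 2 / eps) * (Num.sqrt (p * q)%:R + Num.sqrt (r * s)%:R).
Proof.
move=> Eiid eps0 b1 pq0.
pose n := (p * q + r * s)%N.
pose t : R := Num.sqrt n%:R.
have n1 : 1 <= n%:R :> R by rewrite ler1n addn_gt0 pq0.
have tt : t ^+ 2 = n%:R by rewrite sqr_sqrtr ?ler0n.
have t0 : 0 < t by rewrite sqrtr_gt0 (lt_le_trans ltr01).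
pose Z := {ffun 'I_(p * q) -> bool * 'I_(4 * (p * q)).+1}.
pose Z' := {ffun 'I_(r * s) -> bool * 'I_(4 * (r * s)).+1}.
pose K (z : Z) (z' : Z') :=
  t *: kron (vec_inv (netpt R z)) (vec_inv (netpt R z')).
pose F z z' w := netwt R z * netwt R z' *
  expR (frobdot (K z z') (E w) - frob (K z z') ^+ 2 / 2).
pose W w := \sum_z \sum_z' F z z' w.
have wt0 p' L (z : {ffun 'I_p' -> bool * 'I_L}) : 0 <= netwt R z.
  exact: expR_ge0.
have F0 z z' w : 0 <= F z z' w by rewrite mulr_ge0 ?expR_ge0// mulr_ge0.
have mE : forall i j, measurable_fun setT (fun w => E w i j) by case: Eiid.
have mF z z' : measurable_fun setT (F z z').
  apply: measurable_funM => //; apply: measurableT_comp => //.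
  by apply: measurable_funB => //; exact: measurable_frobdot.
have intF z z' : (\int[P]_w (F z z' w)%:E = (netwt R z * netwt R z')%:E)%E.
  transitivity (\int[P]_w ((netwt R z * netwt R z' *
      expR (- (frob (K z z') ^+ 2 / 2)))%:E *
      (expR (frobdot (K z z') (E w)))%:E))%E.
    apply: eq_integral => w _.
    by rewrite -EFinM /F expRD; congr EFin; ring.
  rewrite ge0_integralZl_EFin//.
  - rewrite integral_expR_frobdot// -EFinM; congr EFin.
    have e1 : expR (- (frob (K z z') ^+ 2 / 2)) *
        expR (frob (K z z') ^+ 2 / 2) = 1.
      by rewrite -expRD addNr expR0.
    by rewrite -[LHS]mulrA e1 mulr1.
  - apply/measurable_EFinP; apply: measurableT_comp => //.
    exact: measurable_frobdot.
  - by rewrite mulr_ge0 ?expR_ge0// mulr_ge0.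
(* every exponential in W is normalised, so the mean of W is the total weight *)
have [] := @probability_le_inv W eps eps0.
- by apply: measurable_sum => z; apply: measurable_sum => z'.
- by move=> w; apply: sumr_ge0 => z _; apply: sumr_ge0.
- under eq_integral do rewrite /W -sumEFin.
  rewrite ge0_integral_sum//; last 2 first.
  + move=> z; apply/measurable_EFinP; apply: measurable_sum => z' //.
  + by move=> z w _; rewrite lee_fin sumr_ge0.
  have intFz z : (\int[P]_w (\sum_z' F z z' w)%:E =
      (netwt R z * \sum_(z' : Z') netwt R z')%:E)%E.
    under eq_integral do rewrite -sumEFin.
    rewrite ge0_integral_sum//; last 2 first.
    + by move=> z'; apply/measurable_EFinP.
    + by move=> z' w _; rewrite lee_fin.
    under eq_bigr do rewrite intF.
    by rewrite sumEFin mulr_sumr.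
  under eq_bigr do rewrite intFz.
  rewrite sumEFin lee_fin -mulr_suml.
  by rewrite mulr_ile1// ?sumr_ge0// sum_netwt_le1.
move=> mG PG; exists [set w | W w <= eps^-1]; split=> //; split=> // w /= Ww.
have ie0 : 0 < eps^-1 by rewrite invr_gt0.
have tle : t <= Num.sqrt (p * q)%:R + Num.sqrt (r * s)%:R.
  have := sqrtr_ge0 ((p * q)%:R : R); have := sqrtr_ge0 ((r * s)%:R : R).
  have := sqr_sqrtr (ler0n R (p * q)); have := sqr_sqrtr (ler0n R (r * s)).
  move: tt; rewrite natrD; move: (Num.sqrt (p * q)%:R) (Num.sqrt (r * s)%:R).
  move=> x y tt yy xx y0 x0.
  rewrite -(@ler_pXn2r _ 2) ?nnegrE ?addr_ge0 ?(ltW t0)//.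
  by rewrite tt; nra.
(* The factor 2 is that of [specnorm_le_net]. In [13 / 2], 6 comes from the weights and 1/2 from the
   variance term. *)
apply: (@le_trans _ _ (2 * ((13 / 2 + eps^-1) * t))); last first.
  rewrite mulrA (_ : 2 * _ = 13 + 2 / eps); last by field; rewrite gt_eqF.
  by rewrite ler_wpM2l// addr_ge0// divr_ge0// ltW.
apply: (specnorm_le_net b1).
  by rewrite mulr_ge0 ?sqrtr_ge0// addr_ge0// ltW.
move=> u v u1 v1.
have [z [uz z1 sz]] := netpt_approx u1.
have [z' [vz' z'1 sz']] := netpt_approx v1.
exists (netpt R z), (netpt R z'); split => //.
(* A single nonnegative summand is at most [W w <= eps^-1], and [eps^-1 <= expR eps^-1] allows
   taking logarithms. *)
have : F z z' w <= expR eps^-1.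
  apply: le_trans (le_trans Ww _); last first.
    by rewrite (le_trans _ (expR_ge1Dx _))// lerDr.
  apply: le_trans (le_bigsum z' (F0 z ^~ w)) _.
  by apply: (le_bigsum z (fun y => sumr_ge0 _ (fun y' _ => F0 y y' w))).
rewrite /F /netwt -!expRD ler_expR frobdotZl -frobdot_rearr.
have -> : frob (K z z') ^+ 2 =
    n%:R * (frob (netpt R z) * frob (netpt R z')) ^+ 2.
  by rewrite frobZ exprMn real_normK ?num_real// tt frob_kron !frob_vec_inv.
have : (frob (netpt R z) * frob (netpt R z')) ^+ 2 <= 1.
  by rewrite expr_le1 ?mulr_ge0 ?frob_ge0// mulr_ile1 ?frob_ge0.
have sumD p' (y : {ffun 'I_p' -> bool * 'I_(4 * p').+1}) :
    (\sum_i (y i).2 <= 4 * p')%N ->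
    (\sum_i ((y i).2 + 2))%:R <= 6 * p'%:R :> R.
  move=> sy; rewrite -natrM ler_nat big_split/= sum_nat_const card_ord.
  by rewrite (mulnDl 4 2) [(p' * 2)%N]mulnC leq_add2r.
have := sumD _ _ sz; have := sumD _ _ sz'.
have nE : n%:R = (p * q)%:R + (r * s)%:R :> R by rewrite natrD.
set x := frobdot _ _; move: (_ ^+ 2) (\sum_i _)%:R (\sum_i _)%:R => a b' c'.
move=> hb hc a1 h.
(* After multiplication by [t], with [t^2 = n], the left side is at most [6 n + n / 2 + 1 / eps],
   and [n >= 1] turns the last term into [n / eps]. *)
rewrite -(ler_pM2l t0) [leRHS]mulrCA -expr2 tt.
have : n%:R * a <= n%:R by rewrite ler_piMr// ler0n.
have : eps^-1 <= eps^-1 * n%:R by rewrite ler_peMr// ltW.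
by move: hb hc h; rewrite nE; lra.
Qed.

End GaussianMatrix.

(** * Convergence rates of the estimators *)

Theorem theorem1 (R : realType) (d : measure_display) (Omega : measurableType d)
  (P : probability Omega R)
  (m0 n0 m0d n0d : nat -> nat)
  (lam sig : nat -> R)
  (A : forall k, 'M[R]_(2 ^ m0 k, 2 ^ n0 k))
  (B : forall k, 'M[R]_(2 ^ m0d k, 2 ^ n0d k))
  (E : forall k, Omega -> 'M[R]_(2 ^ m0 k * 2 ^ m0d k, 2 ^ n0 k * 2 ^ n0d k)) :
  (* M + N -> oo, with M = m0 + m0d, N = n0 + n0d *)
  (fun k => ((m0 k + m0d k + (n0 k + n0d k))%:R : R)) @ \oo --> +oo ->
  (* Assumption 1 *)
  (fun k => ((m0 k + n0 k)%:R : R) /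
            ln (ln (((m0 k + m0d k) * (n0 k + n0d k))%:R))) @ \oo --> +oo ->
  (fun k => ((m0d k + n0d k)%:R : R) /
            ln (ln (((m0 k + m0d k) * (n0 k + n0d k))%:R))) @ \oo --> +oo ->
  (forall k, 0 < lam k) -> (forall k, 0 < sig k) ->
  (forall k, frob (A k) = 1) -> (forall k, frob (B k) = 1) ->
  (* Assumption 2 *)
  (forall k, iid_std_normal P (E k)) ->
  let Y k w := lam k *: kron (A k) (B k)
      + (sig k / Num.sqrt (2 ^ (m0 k + m0d k + (n0 k + n0d k)))%:R) *: E k w in
  let RY k w := rearr (Y k w) in
  let rate k := ((Num.sqrt (2 ^ (m0 k + n0 k))%:R)^-1
                 + (Num.sqrt (2 ^ (m0d k + n0d k))%:R)^-1) / (lam k / sig k) in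
  (* admissible leading singular pairs, with sign fixed by <vec Ahat, vec A> >= 0 *)
  let adm k w u v := leading_pair (RY k w) u v /\ 0 <= frobdot (vec_inv u) (A k) in
  bigOp P (fun k w x => x = (specnorm (RY k w) - lam k) / lam k) rate /\
  bigOp P (fun k w x => exists u v, adm k w u v /\
                         x = frob (vec_inv u - A k) ^+ 2) rate /\
  bigOp P (fun k w x => exists u v, adm k w u v /\
                         x = frob (vec_inv v - B k) ^+ 2) rate.

Proof.
move=> _ _ _ lam0 sig0 A1 B1 Eiid Y RY rate adm.
pose sz k : nat := (2 ^ (m0 k + m0d k + (n0 k + n0d k)))%N.
pose c k := sig k / Num.sqrt (sz k)%:R.
have c0 k : 0 <= c k by rewrite divr_ge0 ?sqrtr_ge0// ltW.
pose a k := (mxvec (A k))^T; pose b k := (mxvec (B k))^T.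
have a1 k : frob (a k) = 1 by rewrite frob_mxvec.
have b1 k : frob (b k) = 1 by rewrite frob_mxvec.
have RYE k w : RY k w = lam k *: (a k *m (b k)^T) + c k *: rearr (E k w).
  by rewrite /RY /Y rearrD !rearrZ rearr_kron.
have noise eps : 0 < eps -> exists C, 0 < C /\ forall k,
    exists G : set Omega, measurable G /\ (P G >= (1 - eps)%:E)%E /\
    forall w, G w -> specnorm (c k *: rearr (E k w)) / lam k <= C * rate k.
  move=> eps0; exists (13 + 2 / eps); split=> [|k].
    by rewrite addr_gt0// divr_gt0.
  have [|G [mG [PG GE]]] := gaussian_specnorm (Eiid k) eps0 (b1 k).
    by rewrite muln_gt0 !expn_gt0.
  exists G; split=> //; split=> // w Gw.
  rewrite ler_pdivrMr// (le_trans (specnormZ_le _ (b1 k) (c0 k)))//.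
  rewrite (le_trans (ler_wpM2l (c0 k) (GE _ Gw)))//.
  have szE : sz k = (2 ^ (m0 k + n0 k) * 2 ^ (m0d k + n0d k))%N.
    by rewrite /sz addnACA expnD.
  rewrite -!expnD /c /rate szE natrM sqrtrM ?ler0n//.
  have p0 : 0 < Num.sqrt (2 ^ (m0 k + n0 k))%:R :> R.
    by rewrite sqrtr_gt0 ltr0n expn_gt0.
  have q0 : 0 < Num.sqrt (2 ^ (m0d k + n0d k))%:R :> R.
    by rewrite sqrtr_gt0 ltr0n expn_gt0.
  (* An equality: dividing [sqrt P + sqrt Q] by [sqrt (P Q)] gives exactly
     [1 / sqrt Q + 1 / sqrt P], where [P], [Q] are the dimensions of the rearranged matrix. *)
  rewrite le_eqVlt; apply/orP; left; apply/eqP.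
  by field; rewrite !gt_eqF.
(* One event serves all admissible pairs at once, since the perturbation bounds are deterministic
   given the noise norm; this covers the multivalued estimators in [bigOp]. *)
have vectors eps : 0 < eps -> exists C, 0 < C /\ forall k,
    exists G : set Omega, measurable G /\ (P G >= (1 - eps)%:E)%E /\
    forall w, G w -> forall u v, adm k w u v ->
      frob (vec_inv u - A k) ^+ 2 <= C * rate k /\
      frob (vec_inv v - B k) ^+ 2 <= C * rate k.
  move=> eps0; have [C [C0 noiseC]] := noise eps eps0.
  exists (8 * C); split=> [|k]; first by rewrite mulr_gt0.
  have [G [mG [PG GE]]] := noiseC k.
  exists G; split=> //; split=> // w Gw u v [uv ua].
  rewrite !frob_vec_invB; rewrite RYE in uv; rewrite frobdot_vec_inv in ua.
  have [_ /(_ u v uv ua)[ub vb]] :=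
    rank1_perturbation (c k *: rearr (E k w)) (a1 k) (b1 k) (lam0 k).
  have le8 : 8 * (specnorm (c k *: rearr (E k w)) / lam k) <= 8 * C * rate k.
    by rewrite -mulrA ler_wpM2l// GE.
  by split; [exact: le_trans ub le8|exact: le_trans vb le8].
split; last split=> eps eps0.
- move=> eps eps0; have [C [C0 noiseC]] := noise eps eps0.
  exists C; split=> //; exists 0%N => k _; have [G [mG [PG GE]]] := noiseC k.
  exists G; split=> //; split=> // w Gw x ->.
  have [sl _] :=
    rank1_perturbation (c k *: rearr (E k w)) (a1 k) (b1 k) (lam0 k).
  rewrite (le_trans _ (GE w Gw))// normrM normfV (gtr0_norm (lam0 k)) RYE.
  by rewrite ler_pM2r ?invr_gt0.
- have [C [C0 vecC]] := vectors eps eps0.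
  exists C; split=> //; exists 0%N => k _; have [G [mG [PG GE]]] := vecC k.
  exists G; split=> //; split=> // w Gw x [u [v [uv ->]]].
  by rewrite ger0_norm ?sqr_ge0//; have [] := GE w Gw u v uv.
- have [C [C0 vecC]] := vectors eps eps0.
  exists C; split=> //; exists 0%N => k _; have [G [mG [PG GE]]] := vecC k.
  exists G; split=> //; split=> // w Gw x [u [v [uv ->]]].
  by rewrite ger0_norm ?sqr_ge0//; have [] := GE w Gw u v uv.
Qed.
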